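(* Let $m, n \in \mathbb{N}$, $r \in [m]$, $s \in [n]$, $\mathcal{A} \subseteq {[m] \choose \leq r}$ and $\mathcal{B} \subseteq {[n] \choose \leq s}$. If $\mathcal{A}$ and $\mathcal{B}$ are cross-intersecting, then \[|\mathcal{A}||\mathcal{B}| \leq \sum_{i=0}^r {m-1 \choose i-1} \sum_{j=0}^s {n-1 \choose j-1},\] and equality holds if $\mathcal{A} = \{A \in {[m] \choose \leq r} \colon 1 \in A\}$ and $\mathcal{B} = \{B \in {[n] \choose \leq s} \colon 1 \in B\}$.
   Context: $\mathbb{N} = \{1,2,\dots\}$ is the set of positive integers and $[n] = \{1,\dots,n\}$. For a set $X$ and an integer $r \geq 0$, ${X \choose \leq r} = \{A \subseteq X \colon |A| \leq r\}$ is the family of all subsets of $X$ of size at most $r$. A family is a set of sets; families may be empty. Two families $\mathcal{A}$ and $\mathcal{B}$ are cross-intersecting if $A \cap B \neq \emptyset$ for every $A \in \mathcal{A}$ and every $B \in \mathcal{B}$. The binomial coefficient ${a \choose -1}$ is $0$. The right-hand side of the inequality is the product of the two sums. *)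

(* Defs.v *)
From mathcomp Require Import all_boot all_order all_algebra.
From mathcomp Require Import finmap.

Set Implicit Arguments.
Unset Strict Implicit.
Unset Printing Implicit Defensive.

Local Open Scope fset_scope.

(* [n] = {1, ..., n}; for m <= n, [m] is literally a subset of [n], so members
   of families over different ground sets can be intersected in {fset nat}. *)
Definition initseg (n : nat) : {fset nat} := [fset i in iota 1 n].

Definition subsets_le (X : {fset nat}) (r : nat) : {fset {fset nat}} :=
  [fset A in fpowerset X | #|` A| <= r].

Definition cross_intersecting (AA BB : {fset {fset nat}}) : Prop :=
  forall A B : {fset nat}, A \in AA -> B \in BB -> A `&` B != fset0.

(* Binomial coefficient with an integer lower index, zero when it is negative;
   truncated subtraction on nat would wrongly give 'C(a, 0 - 1) = 1. *)
Definition binz (a : nat) (k : int) : nat :=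
  if k is Posz j then 'C(a, j) else 0.

(* Main.v *)
Require Import Defs.
From mathcomp Require Import all_boot all_order all_algebra.
From mathcomp Require Import finmap zify.

Set Implicit Arguments.
Unset Strict Implicit.
Unset Printing Implicit Defensive.

(** The bound is proved for families F and G on ground sets X and Y with X
nonempty and contained in Y, by induction on the size of Y.  Write b(k, r) for
the number of subsets of size less than r of a k-set; a star on X with sets of
size at most r has b(|X| - 1, r) members, and b satisfies the Pascal rule
b(k + 1, r + 1) = b(k, r + 1) + b(k, r).

Given a point y, split F into its deletion F0 (the members without y) and its
link F1 (the members with y, after removing y), and G into G0 and G1.  In the
identity |F| |G| = (|F0| + |F1|) (|G0| + |G1|) each of the four products obeys
the induction hypothesis as soon as the two families in it cross-intersect, and
by the Pascal rule the four bounds add up to the wanted one.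

If y lies in Y but not in X then F0 = F and F1 is empty, and there is nothing
more to do.  If X = Y the only pair that may fail to cross-intersect is
(F1, G1).  Shifting, that is, replacing y by another element of X in the
members of F and G whenever the result is new, keeps the cardinals, the size
bounds and the cross-intersection, and it may be repeated until F is stable.  Then F1 and G1 are almost cross-intersecting: members A of F1 and B of
G1 are disjoint only if they are complementary in X minus y
([compressed_complement]).  Let q be the number of these complementary pairs.

For every such pair, either drop A from F1 and insert its complement into G0,
or drop the complement from G1 and insert A into F0.  Whatever choices are made,
all four pairs of families become cross-intersecting ([complement_transfer]).
Making the first choice q1 times and the second q2 times changes |F| by q2 - q1
and |G| by q1 - q2.  If q is even, q1 = q2 changes nothing and the induction
hypothesis finishes.  If q is odd, take q1 and q2 to differ by 1, in the
direction that brings the two cardinals together; this cannot decrease the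
product unless |F| = |G|.  In that case a violation of the bound would force
equality in all the inductive bounds for both choices of (q1, q2).  These
equalities make the two terms on the right of the Pascal rule equal, so that
all of them are the same power of 2, and they make the square of this power a
product of two consecutive integers, which is impossible ([transfer_bound]). *)

(** * Partial sums of binomial coefficients *)

Definition binsum (k r : nat) : nat := \sum_(i < r) 'C(k, i).

Lemma binsum0r k : binsum k 0 = 0.
Proof. by rewrite /binsum big_ord0. Qed.

Lemma binsumS k r : binsum k.+1 r.+1 = binsum k r.+1 + binsum k r.
Proof.
rewrite /binsum big_ord_recl [X in X + _ = _]/= bin0.
rewrite [X in _ = X + _]big_ord_recl /= bin0 -addnA -big_split /=.
by congr (_ + _); apply: eq_bigr => i _; rewrite binS.
Qed.

Lemma binsum_recr k r : binsum k r.+1 = binsum k r + 'C(k, r).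
Proof. by rewrite /binsum big_ord_recr. Qed.

Lemma binsum0S r : binsum 0 r.+1 = 1.
Proof. by rewrite /binsum big_ord_recl bin0 big1. Qed.

Lemma binsum_gt0 k r : 0 < binsum k r.+1.
Proof. by rewrite /binsum big_ord_recl bin0. Qed.

Lemma binsum_full k r : k < r -> binsum k r = 2 ^ k.
Proof.
elim: k r => [|k IHk] [|r] // lt_kr; first exact: binsum0S.
by rewrite binsumS !IHk ?expnS ?mul2n -?addnn // ltnW.
Qed.

(** Equal consecutive sums have already exhausted the k-th row, so their value
does not depend on r. *)
Lemma binsum_stationary k r : binsum k r.+1 = binsum k r -> binsum k r.+1 = 2 ^ k.
Proof.
rewrite binsum_recr => eq_sum; rewrite -binsum_recr.
by apply/binsum_full/ltnW; rewrite ltnS ltnNge -bin_gt0; lia.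
Qed.

Lemma square_neq_pronic b x : 0 < b -> x * x.+1 <> b * b.
Proof. move=> b_gt0 E; case: (leqP b x) => H; nia. Qed.

(** Here a and b are the sizes of the deletion and the link of F, and c and d
those for G, when a single complementary pair is left and its two members are
not counted in b and d; the n's are the inductive bounds.  The condition
a + b = c + d says that the two families have the same size, so each of the two
ways to resolve the pair loses exactly 1 on the product of the sizes.  As the
n's add up to less than the original product, all eight inequalities are
equalities. *)
Lemma transfer_tight (a b c d n1 n2 n3 n4 : nat) : a + b = c + d ->
  a * c.+1 <= n1 -> a * d.+1 <= n2 -> b * c.+1 <= n3 -> b * d.+1 <= n4 ->
  a.+1 * c <= n1 -> a.+1 * d <= n2 -> b.+1 * c <= n3 -> b.+1 * d <= n4 ->
  n1 + n2 + n3 + n4 < (a + b).+1 * (c + d).+1 ->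
  [/\ b = a, c = a, d = a & [/\ n1 = a * a.+1, n2 = a * a.+1 & n3 = a * a.+1]].
Proof.
move=> eq_s; rewrite !(mulnDl, mulnDr, mulnS, mulSn) => b1 b2 b3 b4 c1 c2 c3 c4 lt.
have : c = a /\ d = a /\ b = a.
  move: b1 b2 b3 b4 c1 c2 c3 c4 lt.
  move: (a * c) (a * d) (b * c) (b * d) => ac ad bc bd ????????; lia.
move=> [? [? ?]]; subst; split=> //; split; lia.
Qed.

(** The arithmetic of the induction step: x, y and z, w are the sizes of
deletion and link of the two families, q counts the complementary pairs, and
the four products p * t, p * t', p' * t, p' * t' are the inductive bounds. *)
Lemma transfer_bound (x y z w q p p' t t' : nat) :
    q <= y -> q <= w -> 0 < p -> 0 < t ->
    (p = p' -> t = t' -> p = t) ->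
    (forall q1 q2, q1 + q2 = q ->
      [/\ (x + q2) * (z + q1) <= p * t, (x + q2) * (w - q2) <= p * t',
          (y - q1) * (z + q1) <= p' * t & (y - q1) * (w - q2) <= p' * t']) ->
  (x + y) * (z + w) <= (p + p') * (t + t').
Proof.
move=> le_qy le_qw p_gt0 t_gt0 eq_pt bnd; set h := q./2.
have sum_bnd q1 q2 : q1 + q2 = q ->
    (x + q2 + (y - q1)) * (z + q1 + (w - q2)) <= (p + p') * (t + t').
  by case/bnd; lia.
have [q_odd | q_even] := boolP (odd q); last first.
  have q_half : h + h = q by rewrite /h; lia.
  have := sum_bnd _ _ q_half.
  by congr (_ * _ <= _); lia.
have q_halves : h.+1 + h = q by rewrite /h; lia.
have q_halves' : h + h.+1 = q by lia.
case: (ltngtP (x + y) (z + w)) => [ltab | ltba | eqab].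
- have := sum_bnd _ _ q_halves'.
  have -> : x + h.+1 + (y - h) = (x + y).+1 by lia.
  have -> : z + h + (w - h.+1) = (z + w).-1 by lia.
  by nia.
- have := sum_bnd _ _ q_halves.
  have -> : x + h + (y - h.+1) = (x + y).-1 by lia.
  have -> : z + h.+1 + (w - h) = (z + w).+1 by lia.
  by nia.
(* Equal sizes and q odd: both nearly even splits are used at once. *)
rewrite leqNgt; apply/negP => gt_ab.
have [b1 b2 b3 b4] := bnd _ _ q_halves.
have [c1 c2 c3 c4] := bnd _ _ q_halves'.
have succ : [/\ x + h.+1 = (x + h).+1, z + h.+1 = (z + h).+1,
    y - h = (y - h.+1).+1 & w - h = (w - h.+1).+1] by split; lia.
move: b1 b2 b3 b4 c1 c2 c3 c4; case: succ => -> -> -> ->.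
set a := x + h => b1 b2 b3 b4 c1 c2 c3 c4.
have [||_ _ _ [f1 f2 f3]] := transfer_tight _ b1 b2 b3 b4 c1 c2 c3 c4.
- by lia.
- move: gt_ab; rewrite !(mulnDl p, mulnDr _ t) !addnA.
  by congr (_ < _ * _); lia.
have ett : t = t' by apply/eqP; rewrite -(eqn_pmul2l p_gt0); apply/eqP; lia.
have epp : p = p' by apply/eqP; rewrite -(eqn_pmul2r t_gt0); apply/eqP; lia.
have ept := eq_pt epp ett.
by apply: (@square_neq_pronic p a p_gt0); rewrite -f1 -ept.
Qed.

(** * Deletion and link of a point *)

Local Open Scope fset_scope.

Implicit Types (A B X Y Z : {fset nat}) (F G Q : {fset {fset nat}}).

Lemma fsetI_neq0P A B : reflect (exists2 z, z \in A & z \in B) (A `&` B != fset0).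
Proof.
apply: (iffP (fset0Pn _)) => [[z /fsetIP[zA zB]] | [z zA zB]]; first by exists z.
by exists z; rewrite inE zA.
Qed.

Lemma fsetI_eq0P A B : reflect {in A, forall z, z \notin B} (A `&` B == fset0).
Proof.
apply: (iffP eqP) => [AB0 z zA | disj].
  by apply/negP => zB; have : z \in A `&` B by [rewrite inE zA]; rewrite AB0.
by apply/fsetP=> z; rewrite !inE; apply/andP=> -[/disj/negP].
Qed.

Lemma in_subsets_le X r A : (A \in subsets_le X r) = (A `<=` X) && (#|` A| <= r).
Proof. by rewrite !inE fpowersetE. Qed.

Lemma cross_intersectingC F G : cross_intersecting F G -> cross_intersecting G F.
Proof. by move=> FG B A BG AF; rewrite fsetIC; apply: FG. Qed.

Definition deletion (y : nat) F : {fset {fset nat}} := [fset A in F | y \notin A].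
Definition link (y : nat) F : {fset {fset nat}} :=
  [fset A `\ y | A in [fset A in F | y \in A]].

Lemma in_deletion y F A : (A \in deletion y F) = (A \in F) && (y \notin A).
Proof. by rewrite !inE. Qed.

Lemma in_link y F A : (A \in link y F) = (y \notin A) && (y |` A \in F).
Proof.
apply/imfsetP/andP => [[B /=] | [yA yAF]].
  rewrite !inE => /andP[BF yB] ->.
  by rewrite fsetD1K ?BF // !inE eqxx.
by exists (y |` A); rewrite ?fsetU1K //= !inE yAF eqxx.
Qed.

Lemma card_deletion_link y F : #|` F| = (#|` deletion y F| + #|` link y F|)%N.
Proof.
have -> : #|` link y F| = #|` [fset A in F | y \in A]|.
  apply: card_in_imfset => A B; rewrite !inE /= => /andP[_ yA] /andP[_ yB] eqAB.
  by rewrite -(fsetD1K yA) eqAB fsetD1K.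
rewrite -cardfsUI [X in (_ = _ + #|` X|)%N](_ : _ = fset0); last first.
  by apply/fsetP => A; rewrite !inE; case: (A \in F); case: (y \in A).
rewrite cardfs0 addn0; congr #|` _|.
by apply/fsetP => A; rewrite !inE; case: (A \in F); case: (y \in A).
Qed.

Lemma deletion_sub y X r F :
  F `<=` subsets_le X r -> deletion y F `<=` subsets_le (X `\ y) r.
Proof.
move=> /fsubsetP FX; apply/fsubsetP => A; rewrite in_deletion => /andP[/FX].
by rewrite !in_subsets_le fsubsetD1 => /andP[-> ->] ->.
Qed.

Lemma link_sub y X r F :
  F `<=` subsets_le X r.+1 -> link y F `<=` subsets_le (X `\ y) r.
Proof.
move=> /fsubsetP FX; apply/fsubsetP => A; rewrite in_link => /andP[yA /FX].
by rewrite !in_subsets_le fsubsetD1 yA fsubUset fsub1set cardfsU1 yA andbT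
  => /andP[/andP[_ ->]].
Qed.

Lemma cross_deletion2 y F G :
  cross_intersecting F G -> cross_intersecting (deletion y F) (deletion y G).
Proof. by move=> FG A B; rewrite !in_deletion => /andP[AF _] /andP[BG _]; apply: FG. Qed.

Lemma cross_deletion_link y F G :
  cross_intersecting F G -> cross_intersecting (deletion y F) (link y G).
Proof.
move=> FG A B; rewrite in_deletion in_link => /andP[AF yA] /andP[_ yBG].
have /fsetI_neq0P[z zA] := FG _ _ AF yBG; rewrite !inE => /predU1P[Ez | zB].
  by rewrite -Ez zA in yA.
by apply/fsetI_neq0P; exists z.
Qed.

Lemma cross_link_deletion y F G :
  cross_intersecting F G -> cross_intersecting (link y F) (deletion y G).
Proof. by move=> FG; apply/cross_intersectingC/cross_deletion_link/cross_intersectingC. Qed.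

(** * The size of a star *)

Lemma deletion_subsets_le y X r : deletion y (subsets_le X r) = subsets_le (X `\ y) r.
Proof.
by apply/fsetP => A; rewrite in_deletion !in_subsets_le fsubsetD1 andbAC.
Qed.

Lemma link_subsets_le y X r :
  y \in X -> link y (subsets_le X r.+1) = subsets_le (X `\ y) r.
Proof.
move=> yX; apply/fsetP => A; rewrite in_link !in_subsets_le fsubsetD1.
rewrite fsubUset fsub1set yX cardfsU1; case: (y \in A); rewrite /= ?andbF ?andbT //.
Qed.

Lemma card_subsets_le X r : #|` subsets_le X r| = binsum #|` X| r.+1.
Proof.
have [k leXk] := ubnP #|` X|; elim: k => // k IHk in X r leXk *.
have [->|[y yX]] := fset_0Vmem X.
  rewrite cardfs0 binsum0S; apply/eqP/cardfs1P; exists fset0.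
  apply/fsetP => A; rewrite in_subsets_le fsubset0 inE.
  by case: eqP => // ->; rewrite cardfs0.
have ltX : #|` X `\ y| < k by move: leXk; rewrite (cardfsD1 y X) yX; lia.
rewrite (card_deletion_link y) deletion_subsets_le IHk // [in RHS](cardfsD1 y) yX.
rewrite add1n binsumS; congr addn; case: r => [|r].
  rewrite binsum0r; apply/eqP; rewrite cardfs_eq0; apply/eqP/fsetP => A.
  by rewrite in_link in_subsets_le cardfsU1 in_fset0; case: (y \in A); rewrite ?andbF.
by rewrite link_subsets_le // IHk.
Qed.

Lemma card_star x X r : x \in X ->
  #|` [fset A in subsets_le X r | x \in A]| = binsum #|` X|.-1 r.
Proof.
move=> xX; set F := [fset A in _ | _].
have del0 : deletion x F = fset0.
  by apply/fsetP => A; rewrite !inE; case: (x \in A); rewrite /= ?andbF.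
have linkF : link x F = link x (subsets_le X r).
  by apply/fsetP => A; rewrite !in_link !inE eqxx andbT.
have -> : #|` X|.-1 = #|` X `\ x| by rewrite (cardfsD1 x X) xX.
rewrite (card_deletion_link x) del0 cardfs0 add0n linkF; case: r {F del0 linkF} => [|r].
  rewrite binsum0r; apply/eqP; rewrite cardfs_eq0; apply/eqP/fsetP => A.
  by rewrite in_link in_subsets_le cardfsU1 in_fset0; case: (x \in A); rewrite ?andbF.
by rewrite link_subsets_le // card_subsets_le.
Qed.

(** * Shifting *)

Definition moved (i y : nat) F A : bool :=
  [&& y \in A, i \notin A & i |` (A `\ y) \notin F].
Definition shift_set (i y : nat) F A : {fset nat} :=
  if moved i y F A then i |` (A `\ y) else A.
Definition shift (i y : nat) F : {fset {fset nat}} := [fset shift_set i y F A | A in F].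

Definition compressed (y : nat) X F : Prop :=
  forall A i, A \in F -> y \in A -> i \in X -> i \notin A -> i |` (A `\ y) \in F.

Lemma card_shift i y F : #|` shift i y F| = #|` F|.
Proof.
apply: card_in_imfset => A B /= AF BF; rewrite /shift_set.
case: ifPn => [/and3P[yA iA iyA] | _]; case: ifPn => [/and3P[yB iB iyB] | _] // E.
- rewrite -(fsetD1K yA) -(fsetD1K yB); congr (_ |` _).
  have iAy C : i \notin C -> i \notin C `\ y by rewrite !inE negb_and orbC => ->.
  by rewrite -(fsetU1K (iAy _ iA)) E fsetU1K ?iAy.
- by rewrite E BF in iyA.
- by rewrite -E AF in iyB.
Qed.

Lemma shift_sub i y X r F :
  i \in X -> F `<=` subsets_le X r -> shift i y F `<=` subsets_le X r.
Proof.
move=> iX /fsubsetP FX; apply/fsubsetP => _ /imfsetP[A /= AF ->].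
have := FX _ AF; rewrite !in_subsets_le /shift_set => /andP[AX leA].
case: ifP => [/and3P[yA iA _] | _]; last by rewrite AX.
rewrite fsubUset fsub1set iX (fsubset_trans (fsubD1set _ _) AX) /=.
by rewrite cardfsU1 !inE (negPf iA) andbF; move: leA; rewrite (cardfsD1 y A) yA.
Qed.

(** If y, a common point of A and B, is the only one and is shifted away from A,
then B, having not moved, either contains i, or has its own shift already in G;
in the latter case A meets that shift, necessarily outside of i and y. *)
Lemma cross_moved_unmoved i y F G A B :
  cross_intersecting F G -> A \in F -> B \in G ->
  moved i y F A -> ~~ moved i y G B -> (i |` (A `\ y)) `&` B != fset0.
Proof.
move=> FG AF BG /and3P[yA iA _] fixB.
have /fsetI_neq0P[z zA zB] := FG _ _ AF BG.
have [zy | zy] := eqVneq z y; last first.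
  by apply/fsetI_neq0P; exists z; rewrite // !inE zy zA orbT.
subst z; have [iB | iB] := boolP (i \in B).
  by apply/fsetI_neq0P; exists i; rewrite // !inE eqxx.
have BG' : i |` (B `\ y) \in G by move: fixB; rewrite /moved zB iB /= negbK.
have /fsetI_neq0P[z zA'] := FG _ _ AF BG'; rewrite !inE => /predU1P[Ez | /andP[zy zB']].
  by rewrite -Ez zA' in iA.
by apply/fsetI_neq0P; exists z; rewrite // !inE zy zA' orbT.
Qed.

Lemma cross_shift i y F G :
  cross_intersecting F G -> cross_intersecting (shift i y F) (shift i y G).
Proof.
move=> FG _ _ /imfsetP[A /= AF ->] /imfsetP[B /= BG ->]; rewrite /shift_set.
case: ifPn => mvA; case: ifPn => mvB.
- by apply/fsetI_neq0P; exists i; rewrite !inE eqxx.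
- exact: cross_moved_unmoved FG AF BG mvA mvB.
- rewrite fsetIC; exact: cross_moved_unmoved (cross_intersectingC FG) BG AF mvB mvA.
- exact: FG.
Qed.

(** A moved set leaves the family and no set containing y enters it, so repeated
shifting terminates. *)
Lemma card_link_shift i y F A : A \in F -> moved i y F A ->
  #|` link y (shift i y F)| < #|` link y F|.
Proof.
move=> AF mvA; have /and3P[yA iA iyA] := mvA.
have iy : y != i by apply: contraNneq iA => <-.
have keep B : y \in B -> B \in shift i y F -> B \in F /\ ~~ moved i y F B.
  move=> yB /imfsetP[C /= CF]; rewrite /shift_set; case: ifPn => [_ EB | fixC ->//].
  by move: yB; rewrite EB !inE eqxx (negPf iy).
apply: fproper_ltn_card; rewrite fproperE; apply/andP; split.
  apply/fsubsetP => B.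
  by rewrite !in_link => /andP[-> /keep[|-> _]] //; rewrite !inE eqxx.
apply/fsubsetPn; exists (A `\ y); first by rewrite in_link fsetD1K // AF !inE eqxx.
rewrite in_link fsetD1K //; apply/negP => /andP[_ /(keep _ yA)[_]].
by rewrite mvA.
Qed.

Lemma exists_compressed y X r s F G : y \in X ->
    F `<=` subsets_le X r -> G `<=` subsets_le X s -> cross_intersecting F G ->
  exists F' G', [/\ F' `<=` subsets_le X r, G' `<=` subsets_le X s,
    cross_intersecting F' G', compressed y X F' &
    #|` F'| = #|` F| /\ #|` G'| = #|` G|].
Proof.
move=> yX; have [k lek] := ubnP #|` link y F|; elim: k => // k IHk in F G lek *.
move=> FX GX FG.
have [/hasP[A AF /hasP[i iX mvA]] | stable] :=
  boolP (has (fun A => has (fun i => moved i y F A) X) F).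
  have [||||F' [G' [F'X G'X FG' cp [cF cG]]]] := IHk (shift i y F) (shift i y G).
  - by apply: leq_trans (card_link_shift AF mvA) _.
  - exact: shift_sub iX FX.
  - exact: shift_sub iX GX.
  - exact: cross_shift.
  by exists F', G'; split=> //; rewrite cF cG !card_shift.
exists F, G; split=> // A i AF yA iX iA; apply/negPn/negP => iyA.
case/negP: stable; apply/hasP; exists A => //; apply/hasP; exists i => //.
by rewrite /moved yA iA.
Qed.

(** * Disjoint members of the two links *)

(** A point z of X other than y outside A and B could replace y in the member
y |` A of F, and the result would miss the member y |` B of G. *)
Lemma compressed_complement y X F G A B :
    compressed y X F -> cross_intersecting F G ->
    A \in link y F -> B \in link y G -> A `<=` X `\ y -> B `<=` X `\ y ->
  A `&` B = fset0 -> B = (X `\ y) `\` A.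
Proof.
move=> cp FG; rewrite !in_link => /andP[yA AF] /andP[yB BG] AX BX /eqP.
move=> /fsetI_eq0P AB; apply/eqP; rewrite eqEfsubset; apply/andP; split.
  apply/fsubsetP => z zB; rewrite inE (fsubsetP BX z zB) andbT.
  by apply/negP => /AB; rewrite zB.
apply/fsubsetP => z; rewrite !inE => /and3P[zA zy zX]; apply/negPn/negP => zB.
have zyA : z \notin y |` A by rewrite !inE negb_or zy.
have := cp _ _ AF (fset1U1 _ _) zX zyA; rewrite fsetU1K // => AF'.
have /fsetI_neq0P[t] := FG _ _ AF' BG; rewrite !inE.
move=> /predU1P[->|tA] /predU1P[Et|tB].
- by rewrite Et eqxx in zy.
- by rewrite tB in zB.
- by rewrite -Et tA in yA.
- by have := AB _ tA; rewrite tB.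
Qed.

Lemma fsubset_of_card F k : k <= #|` F| -> exists2 G, G `<=` F & #|` G| = k.
Proof.
elim: k => [|k IHk] lek; first by exists fset0; rewrite ?fsub0set ?cardfs0.
have [G GF cG] := IHk (ltnW lek).
have /fsubsetPn[A AF AG] : ~~ (F `<=` G).
  by apply: contraTN lek => /fsubset_leq_card; rewrite cG; lia.
by exists (A |` G); [rewrite fsubUset fsub1set AF | rewrite cardfsU1 AG cG].
Qed.

Lemma cardfsU_disjoint F G : (forall A, A \in F -> A \notin G) ->
  #|` F `|` G| = (#|` F| + #|` G|)%N.
Proof.
move=> FG; rewrite -cardfsUI [F `&` G](_ : _ = fset0) ?cardfs0 ?addn0 //.
by apply/fsetP => A; rewrite !inE; apply/andP => -[/FG/negP].
Qed.

(** With P the set of those A in F1 whose complement is in G1, split P into P1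
and P2 of sizes q1 and q2, drop P1 from F1 and insert its complements into G0,
and drop the complements of P2 from G1 and insert P2 into F0.  A disjoint pair
created by this would have to be a complementary pair of members of F1 and G1,
hence of the form (A, Z `\` A) with A in P, and in each of the four pairs of
families one of its halves is absent.  The insertions are of new sets, because
a complementary pair would otherwise violate the cross-intersection of F0 with
G1 or of F1 with G0. *)
Lemma complement_transfer Z r s F0 F1 G0 G1 :
    F0 `<=` subsets_le Z r.+1 -> F1 `<=` subsets_le Z r ->
    G0 `<=` subsets_le Z s.+1 -> G1 `<=` subsets_le Z s ->
    cross_intersecting F0 G0 -> cross_intersecting F0 G1 ->
    cross_intersecting F1 G0 ->
    (forall A B, A \in F1 -> B \in G1 -> A `&` B = fset0 -> B = Z `\` A) ->
  exists q, [/\ q <= #|` F1|, q <= #|` G1| & forall q1 q2, (q1 + q2)%N = q ->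
  exists F0' F1' G0' G1',
  [/\ [/\ F0' `<=` subsets_le Z r.+1, F1' `<=` subsets_le Z r,
          G0' `<=` subsets_le Z s.+1 & G1' `<=` subsets_le Z s],
      [/\ cross_intersecting F0' G0', cross_intersecting F0' G1',
          cross_intersecting F1' G0' & cross_intersecting F1' G1'] &
      [/\ #|` F0'| = (#|` F0| + q2)%N, #|` F1'| = #|` F1| - q1,
          #|` G0'| = (#|` G0| + q1)%N & #|` G1'| = #|` G1| - q2]]].
Proof.
move=> F0Z F1Z G0Z G1Z X00 X01 X10 compl.
pose co A := Z `\` A; pose P := [fset A in F1 | co A \in G1].
have PF A : A \in P -> A \in F1 by rewrite !inE => /andP[].
have PG A : A \in P -> co A \in G1 by rewrite !inE => /andP[].
have inZ A : A \in F1 -> A `<=` Z.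
  by move/(fsubsetP F1Z); rewrite in_subsets_le => /andP[].
have coK A : A `<=` Z -> co (co A) = A.
  by move=> AZ; rewrite /co fsetDK.
have coI A : A `&` co A = fset0.
  by apply/eqP/fsetI_eq0P => z zA; rewrite inE zA.
pose cof Q : {fset {fset nat}} := [fset co A | A in Q].
have card_cof Q : Q `<=` P -> #|` cof Q| = #|` Q|.
  move=> /fsubsetP QP; apply: card_in_imfset => A B /= /QP/PF/inZ AZ /QP/PF/inZ BZ E.
  by rewrite -(coK _ AZ) E coK.
have cofG Q : Q `<=` P -> cof Q `<=` G1.
  by move=> /fsubsetP QP; apply/fsubsetP=> _ /imfsetP[A /= /QP/PG ? ->].
have grow k : subsets_le Z k `<=` subsets_le Z k.+1.
  apply/fsubsetP => A; rewrite !in_subsets_le => /andP[-> le] /=; exact: leqW.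
exists #|` P|; split.
- by apply/fsubset_leq_card/fsubsetP.
- rewrite -(card_cof P) //; exact/fsubset_leq_card/cofG.
move=> q1 q2 Eq.
have [|P1 P1P cP1] := @fsubset_of_card P q1; first by lia.
pose P2 := P `\` P1.
have P2P : P2 `<=` P by apply: fsubsetDl.
have cP2 : #|` P2| = q2 by rewrite cardfsDS // cP1; lia.
have PF' Q : Q `<=` P -> Q `<=` F1 by move=> /fsubsetP QP; apply/fsubsetP => A /QP/PF.
(* Over the two links, only a complementary pair can fail to meet. *)
have meet A B : A \in F1 -> B \in G1 -> (A \in P -> B != co A) -> A `&` B != fset0.
  move=> AF BG nco; apply/negP => /eqP AB0; have EB := compl _ _ AF BG AB0.
  by move: nco; rewrite !inE AF -[co A]EB BG eqxx => /(_ isT).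
exists (F0 `|` P2), (F1 `\` P1), (G0 `|` cof P1), (G1 `\` cof P2).
have cofP Q B : B \in cof Q -> exists2 A, A \in Q & B = co A.
  by move=> /imfsetP[A /= AQ ->]; exists A.
split.
- split.
  + by rewrite fsubUset F0Z (fsubset_trans (PF' _ P2P)) // (fsubset_trans F1Z).
  + exact: fsubset_trans (fsubsetDl _ _) F1Z.
  + by rewrite fsubUset G0Z (fsubset_trans (cofG _ P1P)) // (fsubset_trans G1Z).
  + exact: fsubset_trans (fsubsetDl _ _) G1Z.
- split.
  + move=> A B /fsetUP[AF|AP2] /fsetUP[BG|BP1].
    * exact: X00.
    * by apply: X01 => //; apply: (fsubsetP (cofG _ P1P)).
    * by apply: X10 => //; apply/PF/(fsubsetP P2P).
    have AP := fsubsetP P2P _ AP2.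
    apply: meet; [exact: PF | exact: (fsubsetP (cofG _ P1P)) | move=> _].
    have [A' A'P1 ->] := cofP _ _ BP1.
    apply: contraTneq AP2 => E; rewrite inE -[A](coK) ?inZ ?PF // -E.
    by rewrite coK ?A'P1 // inZ // PF // (fsubsetP P1P).
  + move=> A B /fsetUP[AF|AP2] /fsetDP[BG BP2]; first exact: X01.
    apply: meet => //; first exact/PF/(fsubsetP P2P).
    by move=> _; apply: contraNneq BP2 => ->; apply: in_imfset.
  + move=> A B /fsetDP[AF AP1] /fsetUP[BG|BP1]; first exact: X10.
    apply: meet => //; first exact: (fsubsetP (cofG _ P1P)).
    move=> _; have [A' A'P1 ->] := cofP _ _ BP1.
    apply: contraNneq AP1 => E; rewrite -[A](coK) ?inZ // -E.
    by rewrite coK ?A'P1 // inZ // PF // (fsubsetP P1P).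
  + move=> A B /fsetDP[AF AP1] /fsetDP[BG BP2].
    apply: meet => // AP; apply: contraNneq BP2 => ->.
    by apply: in_imfset; rewrite /= inE AP1.
split.
- rewrite cardfsU_disjoint ?cP2 // => A AF; apply/negP => /(fsubsetP P2P)/PG.
  by move=> /(X01 _ _ AF); rewrite coI eqxx.
- by rewrite cardfsDS ?cP1 // PF'.
- rewrite cardfsU_disjoint ?card_cof ?cP1 // => B BG; apply/negP => /cofP[A AP1 EB].
  have := X10 A B (PF _ (fsubsetP P1P _ AP1)) BG.
  by rewrite EB coI eqxx.
- by rewrite cardfsDS ?cofG // card_cof ?cP2.
Qed.

Lemma cross_intersecting_fset0 F G :
  fset0 \in F -> cross_intersecting F G -> G = fset0.
Proof.
move=> F0 FG; apply/eqP; apply/negPn/negP => /fset0Pn[B BG].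
by have := FG _ _ F0 BG; rewrite fset0I eqxx.
Qed.

Lemma cross_subsets_le0 X F G :
    F `<=` subsets_le X 0 -> cross_intersecting F G -> #|` F| * #|` G| = 0.
Proof.
move=> /fsubsetP FX FG; have [-> | [A AF]] := fset_0Vmem F; first by rewrite cardfs0.
have A0 : A = fset0.
  by have := FX _ AF; rewrite in_subsets_le leqn0 cardfs_eq0 => /andP[_ /eqP].
by rewrite A0 in AF; rewrite (cross_intersecting_fset0 AF FG) cardfs0 muln0.
Qed.

(** The inclusion of X in Y is what makes the induction run on |Y| alone: while it
is strict there is a point outside X to remove from Y, and once X = Y a point
can be removed from both. *)
Lemma cross_intersecting_subsets_le X Y r s F G :
    X != fset0 -> X `<=` Y ->
    F `<=` subsets_le X r -> G `<=` subsets_le Y s -> cross_intersecting F G ->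
  #|` F| * #|` G| <= binsum #|` X|.-1 r * binsum #|` Y|.-1 s.
Proof.
have [l leYl] := ubnP #|` Y|; elim: l => // l IHl in X Y r s F G leYl *.
move=> X0 XY FX GY FG.
case: r FX => [|r] FX; first by rewrite (cross_subsets_le0 FX FG).
case: s GY => [|s] GY.
  by rewrite mulnC (cross_subsets_le0 GY (cross_intersectingC FG)).
have cardD1 y Z : y \in Z -> #|` Z| = #|` Z `\ y|.+1.
  by move=> yZ; rewrite (cardfsD1 y Z) yZ.
(* A point outside the smaller ground set splits G only. *)
have [/fsubsetPn[y yY yX] | ] := boolP (~~ (Y `<=` X)).
  have XYy : X `<=` Y `\ y by rewrite fsubsetD1 XY.
  have cY := cardD1 _ _ yY.
  have cYy : #|` Y `\ y| = (#|` Y `\ y|.-1).+1.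
    by rewrite prednK // (leq_trans _ (fsubset_leq_card XYy)) // cardfs_gt0.
  have ltY : #|` Y `\ y| < l by lia.
  have delF : deletion y F = F.
    apply/fsetP => A; rewrite in_deletion; have [AF|//] := boolP (A \in F).
    have := fsubsetP FX _ AF; rewrite in_subsets_le => /andP[AX _].
    by apply: contra yX; apply: (fsubsetP AX).
  have Fdel : cross_intersecting F (deletion y G).
    by rewrite -delF; apply: cross_deletion2.
  have Flink : cross_intersecting F (link y G).
    by rewrite -delF; apply: cross_deletion_link.
  rewrite (card_deletion_link y G) cY /= cYy binsumS !mulnDr leq_add //.
    exact: IHl ltY X0 XYy FX (deletion_sub y GY) Fdel.
  exact: IHl ltY X0 XYy FX (link_sub y GY) Flink.
rewrite negbK => YX; have {XY YX} EXY : X = Y by apply/eqP; rewrite eqEfsubset XY.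
subst Y; have /fset0Pn[y yX] := X0.
have [F1 [G1 [{}FX {}GX {}FG cpF [<- <-]]]] := exists_compressed yX FX GY FG.
(* On a one-point ground set, a family without the empty set has at most one
member. *)
have [Xy0 | Xy0] := eqVneq (X `\ y) fset0.
  rewrite (cardD1 _ _ yX) Xy0 cardfs0 !binsum0S.
  have le1 H t : H `<=` subsets_le X t -> fset0 \notin H -> #|` H| <= 1.
    move=> /fsubsetP HX H0; rewrite -(cardfs1 X); apply/fsubset_leq_card/fsubsetP => A AH.
    have : A `<=` [fset y].
      have := HX _ AH; rewrite in_subsets_le => /andP[AX _].
      by rewrite -(fsetD1K yX) Xy0 fsetU0 in AX.
    rewrite fsubset1 inE => /orP[/eqP-> | /eqP A0].
      by rewrite -(fsetD1K yX) Xy0 fsetU0.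
    by rewrite A0 (negPf H0) in AH.
  have [F0 | F0] := boolP (fset0 \in F1).
    by rewrite (cross_intersecting_fset0 F0 FG) cardfs0 muln0.
  have [G0 | G0] := boolP (fset0 \in G1).
    by rewrite (cross_intersecting_fset0 G0 (cross_intersectingC FG)) cardfs0.
  exact: leq_mul (le1 _ _ FX F0) (le1 _ _ GX G0).
have cX := cardD1 _ _ yX; have ltX : #|` X `\ y| < l by lia.
have [k ck] : exists k, #|` X `\ y| = k.+1.
  by exists #|` X `\ y|.-1; rewrite prednK // cardfs_gt0.
have inX H t A : H `<=` subsets_le X t.+1 -> A \in link y H -> A `<=` X `\ y.
  by move=> /(link_sub y)/fsubsetP HX /HX; rewrite in_subsets_le => /andP[].
have [||||||||q [qF qG transfer]] := @complement_transfer (X `\ y) r s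
    (deletion y F1) (link y F1) (deletion y G1) (link y G1).
- exact: deletion_sub.
- exact: link_sub.
- exact: deletion_sub.
- exact: link_sub.
- exact: cross_deletion2.
- exact: cross_deletion_link.
- exact: cross_link_deletion.
- move=> A B AF BG; apply: (compressed_complement cpF FG AF BG).
    exact: inX FX AF.
  exact: inX GX BG.
rewrite (card_deletion_link y F1) (card_deletion_link y G1) cX ck /= !binsumS.
apply: (transfer_bound qF qG (binsum_gt0 _ _) (binsum_gt0 _ _)).
  by move=> /binsum_stationary-> /binsum_stationary->.
move=> q1 q2 /transfer[F0' [F1' [G0' [G1' [[F0X F1X G0X G1X] [X00 X01 X10 X11]]]]]].
case=> <- <- <- <-.
have bound t u H K : H `<=` subsets_le (X `\ y) t -> K `<=` subsets_le (X `\ y) u ->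
    cross_intersecting H K -> #|` H| * #|` K| <= binsum k t * binsum k u.
  move=> HX KX HK; have := IHl (X `\ y) (X `\ y) t u H K ltX Xy0 (fsubset_refl _).
  by rewrite ck; apply.
by split; apply: bound.
Qed.

(** * The theorem for initial segments *)

Lemma card_initseg n : #|` initseg n| = n.
Proof. by rewrite card_fseq undup_id ?iota_uniq // size_iota. Qed.

Lemma in_initseg n i : (i \in initseg n) = (0 < i <= n).
Proof. by rewrite inE mem_iota add1n ltnS. Qed.

Lemma initseg_sub m n : m <= n -> initseg m `<=` initseg n.
Proof.
move=> lemn; apply/fsubsetP => i; rewrite !in_initseg => /andP[-> /=].
by move/leq_trans; apply.
Qed.

Lemma sum_binz k r : \sum_(0 <= i < r.+1) binz k (i%:Z - 1)%R = binsum k r.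
Proof.
rewrite big_nat_recl // add0n big_mkord; apply: eq_bigr => i _.
by rewrite -[i.+1]addn1 PoszD GRing.addrK.
Qed.

Theorem theorem1p1 (m n r s : nat) (AA BB : {fset {fset nat}})
    (m_gt0 : 0 < m) (n_gt0 : 0 < n)
    (r_in : r \in initseg m) (s_in : s \in initseg n)
    (AA_sub : AA `<=` subsets_le (initseg m) r)
    (BB_sub : BB `<=` subsets_le (initseg n) s)
    (AABB : cross_intersecting AA BB) :
  #|` AA| * #|` BB| <=
    (\sum_(0 <= i < r.+1) binz (m - 1) (i%:Z - 1)%R) *
    (\sum_(0 <= j < s.+1) binz (n - 1) (j%:Z - 1)%R)
  /\ (AA = [fset A in subsets_le (initseg m) r | 1 \in A] ->
      BB = [fset B in subsets_le (initseg n) s | 1 \in B] ->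
      #|` AA| * #|` BB| =
        (\sum_(0 <= i < r.+1) binz (m - 1) (i%:Z - 1)%R) *
        (\sum_(0 <= j < s.+1) binz (n - 1) (j%:Z - 1)%R)).
Proof.
rewrite !sum_binz !subn1; split; last first.
  by move=> -> ->; rewrite !card_star ?in_initseg // !card_initseg.
have initseg_neq0 k : 0 < k -> initseg k != fset0.
  by rewrite -cardfs_gt0 card_initseg.
have [lemn | /ltnW lenm] := leqP m n.
  have := cross_intersecting_subsets_le (initseg_neq0 _ m_gt0)
    (initseg_sub lemn) AA_sub BB_sub AABB.
  by rewrite !card_initseg.
have := cross_intersecting_subsets_le (initseg_neq0 _ n_gt0)
  (initseg_sub lenm) BB_sub AA_sub (cross_intersectingC AABB).
by rewrite !card_initseg mulnC [X in _ <= X]mulnC.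
Qed.
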